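(* Let $\delta>0$ and, for $\omega\in\{0,1\}^d$, let $$M_{\delta,\omega}=\Big(\frac{e^{\delta/2}}{e^{\delta/2}+1}\Big)^{d/2}\sum_{k=1}^de^{-\frac\delta4\|\omega-e_k\|_1}|k\rangle\langle k|,$$ where $(|k\rangle)_{k=1}^d$ is a fixed orthonormal basis of $\mathbb C^d$ and $e_k\in\{0,1\}^d$ is the $k$-th standard basis vector. Then the family $M_\delta=(M_{\delta,\omega})_{\omega\in\{0,1\}^d}$ defines a quantum measurement that is $\delta$-quantum-differentially-private and $\alpha$-gentle on $\mathcal S(\mathbb C^d)$ for $\alpha=\tanh(\delta/4)$. Moreover, for a pure state $\rho=|\psi\rangle\langle\psi|$ with $|\psi\rangle=\sum_{j=1}^d\gamma_j|j\rangle$, $\|\psi\|=1$, the resulting random variable $R^{M_\delta}$ has likelihood $$\mathbb P_\rho\big(R^{M_\delta}=\omega\big)=\Big(\frac{e^{\delta/2}}{e^{\delta/2}+1}\Big)^d\sum_{j=1}^d|\gamma_j|^2e^{-\frac\delta2\|\omega-e_j\|_1},$$ and the post-measurement states are $$\rho_{M_\delta\to\omega}=\frac1{\mathbb P_\rho(R^{M_\delta}=\omega)}M_{\delta,\omega}\,\rho\,M_{\delta,\omega}^*.$$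
   Context: $\mathcal S(\mathbb C^d)$ is the set of density matrices (positive semidefinite, trace 1) on $\mathbb C^d$. A measurement on $\mathbb C^d$ is a countable family $M=(M_\omega)_{\omega\in\Omega}$ of matrices in $\mathbb C^{d\times d}$ with $\sum_\omega M_\omega^*M_\omega=\mathbb 1$; put $E_\omega=M_\omega^*M_\omega$. Measuring $\rho$ yields a random outcome $R^M$ with $\mathbb P_\rho(R^M=\omega)=\operatorname{Tr}[\rho E_\omega]$ and, if this is positive, the post-measurement state $\rho_{M\to\omega}=M_\omega\rho M_\omega^*/\operatorname{Tr}[\rho E_\omega]$. With $\|A\|_{Tr}=\frac12\operatorname{Tr}|A|$, $M$ is $\alpha$-gentle on $\mathcal S\subseteq\mathcal S(\mathbb C^d)$ if $\|\rho-\rho_{M\to\omega}\|_{Tr}\le\alpha$ for all $\rho\in\mathcal S$ and all outcomes $\omega$ (of positive probability). $M$ is $\delta$-quantum-differentially-private on $\mathcal S$ if $\mathbb P_{\rho_1}(R^M=\omega)\le e^\delta\,\mathbb P_{\rho_2}(R^M=\omega)$ for all $\rho_1,\rho_2\in\mathcal S$ and $\omega\in\Omega$. *)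

(* Defs.v *)
From HB Require Import structures.
From mathcomp Require Import all_boot all_order all_algebra finmap.
From mathcomp Require Import sesquilinear spectral complex.
From mathcomp Require Import classical_sets reals topology normedtype sequences exp.
From mathcomp Require Import summability.

Set Implicit Arguments.
Unset Strict Implicit.
Unset Printing Implicit Defensive.

Import Order.TTheory GRing.Theory Num.Theory.
Import numFieldTopology.Exports.

Local Open Scope classical_set_scope.
Local Open Scope complex_scope.
Local Open Scope ring_scope.
Local Open Scope sesquilinear_scope.

Section Matrices.
Context {C : numClosedFieldType} {d : nat}.

(* Conjugate-linear in the first argument. *)
Definition inner (u v : 'cV[C]_d) : C := (u ^t* *m v) 0 0.

Definition vnorm (u : 'cV[C]_d) : C := sqrtC (inner u u).

Definition outer (u v : 'cV[C]_d) : 'M[C]_d := u *m v ^t*.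

(* [d] orthonormal vectors of C^d automatically span C^d. *)
Definition orthonormal_basis (ket : 'I_d -> 'cV[C]_d) : Prop :=
  forall i j, inner (ket i) (ket j) = (i == j)%:R.

(* [0 <= x] in [C] entails that [x] is real, so this implies [A = A ^t*]. *)
Definition psdmx (A : 'M[C]_d) : Prop :=
  forall u : 'cV[C]_d, 0 <= inner u (A *m u).

Definition density : set 'M[C]_d := [set rho | psdmx rho /\ \tr rho = 1].

(* [|A|], the positive square root of [A^* A] by functional calculus. *)
Definition absmx (A : 'M[C]_d) : 'M[C]_d :=
  let G := A ^t* *m A in
  invmx (spectralmx G) *m diag_mx (map_mx sqrtC (spectral_diag G))
    *m spectralmx G.

Definition trace_norm (A : 'M[C]_d) : C := 2^-1 * \tr (absmx A).

Section Measurements.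
Context {Omega : countType}.
Implicit Types (M : Omega -> 'M[C]_d) (rho : 'M[C]_d) (w : Omega).

Definition effect M w : 'M[C]_d := (M w) ^t* *m M w.

(* The sum over the countable outcome set is the limit of the net of its finite
   partial sums, in the (entrywise) topology of matrices. *)
Definition is_measurement M : Prop :=
  partial_sum (effect M) @ totally --> (1%:M : 'M[C]_d).

Definition prob M rho w : C := \tr (rho *m effect M w).

(* Meaningful only when [0 < prob M rho w]. *)
Definition post_state M rho w : 'M[C]_d :=
  (prob M rho w)^-1 *: (M w *m rho *m (M w) ^t*).

End Measurements.
End Matrices.

Section Privacy.
Context {R : realType} {d : nat} {Omega : countType}.
Implicit Types (S : set 'M[R[i]]_d) (M : Omega -> 'M[R[i]]_d).

Definition gentle (alpha : R) S M : Prop :=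
  forall rho w, S rho -> 0 < prob M rho w ->
    trace_norm (rho - post_state M rho w) <= alpha%:C.

Definition quantum_dp (delta : R) S M : Prop :=
  forall rho1 rho2 w, S rho1 -> S rho2 ->
    prob M rho1 w <= (expR delta)%:C * prob M rho2 w.

End Privacy.

Section Mechanism.
Context {R : realType} {d : nat}.

Definition tanh (x : R) : R :=
  (expR x - expR (- x)) / (expR x + expR (- x)).

Definition std_basis (k : 'I_d) : {ffun 'I_d -> bool} := [ffun i => i == k].

Definition l1dist (u v : {ffun 'I_d -> bool}) : R :=
  \sum_i `|(u i)%:R - (v i)%:R|.

Definition meas_delta (delta : R) (ket : 'I_d -> 'cV[R[i]]_d)
    (w : {ffun 'I_d -> bool}) : 'M[R[i]]_d :=
  ((expR (delta / 2) / (expR (delta / 2) + 1)) `^ (d%:R / 2))%:C *: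
  \sum_k (expR (- (delta / 4) * l1dist w (std_basis k)))%:C
           *: outer (ket k) (ket k).

End Mechanism.

(* Main.v *)
Require Import Defs.
From HB Require Import structures.
From mathcomp Require Import all_boot all_order all_algebra.
From mathcomp Require Import spectral complex classical_sets reals sequences.
From mathcomp Require Import exp.
From mathcomp Require Import finmap sesquilinear topology summability.
From mathcomp Require Import ring.

(** A bit string [w] with [|w|] ones differs from the basis string [e_k] in
    [|w| + 1] places if [w k] is false and in [|w| - 1] places if it is true.
    Hence the matrix [M_w] of the mechanism has only two levels: with [P] the
    orthogonal projector onto the kets [k] selected by [w],
    [M_w = m (1 - P) + h P], where [h = expR (delta / 2) m]
    ([meas_delta_two_level]).

    Write a density matrix as [rho = X X^t*], where [X] has Hilbert-Schmidt norm
    1, and put [p = \tr (rho P)], a number of [0, 1].  The probability of the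
    outcome is [q = m^2 (1 - p) + h^2 p], so it lies between [m^2] and [h^2],
    whose ratio is [expR delta]: this is privacy.

    For gentleness, the matrix [X] serves as a purification of [rho].  The
    post-measurement state is [Y Y^t*] with [Y = q^-1/2 M_w X], again of norm 1,
    and the pure-state bound
    [trace_norm (X X^t* - Y Y^t* ) <= sqrt (1 - t^2)], [t = <X, Y>],
    remains valid for purifications ([trace_norm_purification]).  Here
    [t^2 = s^2 / q] with [s = m (1 - p) + h p], and completing a square gives
    [1 - t^2 = ((h - m) / (h + m))^2 (1 - ((1 - p) m - p h)^2 / q)],
    hence the bound [(h - m) / (h + m) = tanh (delta / 4)]
    ([two_level_gentle]).

    The effects [M_w^t* M_w] are diagonal in the orthonormal basis, so their
    sum is computed entry by entry; each entry is a sum over bit strings of a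
    product over positions, which factors and equals 1. *)

Set Implicit Arguments.
Unset Strict Implicit.
Unset Printing Implicit Defensive.

Import Order.TTheory GRing.Theory Num.Theory.
Import numFieldTopology.Exports.

Local Open Scope complex_scope.
Local Open Scope ring_scope.
Local Open Scope sesquilinear_scope.

(** * Hilbert-Schmidt inner product *)

Section HilbertSchmidt.
Context {C : numClosedFieldType}.

Lemma adjmxM m n p (A : 'M[C]_(m, n)) (B : 'M[C]_(n, p)) :
  (A *m B) ^t* = B ^t* *m A ^t*.
Proof. by rewrite trmx_mul map_mxM. Qed.

Lemma adjmxD m n (A B : 'M[C]_(m, n)) : (A + B) ^t* = A ^t* + B ^t*.
Proof. by rewrite linearD map_mxD. Qed.

Lemma adjmxB m n (A B : 'M[C]_(m, n)) : (A - B) ^t* = A ^t* - B ^t*.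
Proof. by rewrite linearB map_mxB. Qed.

Lemma adjmxZ m n (a : C) (A : 'M[C]_(m, n)) : (a *: A) ^t* = a^* *: A ^t*.
Proof. by rewrite linearZ map_mxZ. Qed.

Lemma adjmx1 n : (1%:M : 'M[C]_n) ^t* = 1%:M.
Proof. by rewrite trmx1 map_mx1. Qed.

Lemma adjmx_diag n (a : 'rV[C]_n) :
  (diag_mx a) ^t* = diag_mx (map_mx Num.conj a).
Proof. by rewrite tr_diag_mx map_diag_mx. Qed.

Definition hsdot m n (A B : 'M[C]_(m, n)) : C := \tr (A *m B ^t*).

(** Flattening matrices into rows identifies this form with the usual dot
    product, which provides positivity and the Cauchy-Schwarz inequality. *)
Lemma hsdotE m n (A B : 'M[C]_(m, n)) : hsdot A B = dotmx (mxvec A) (mxvec B).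
Proof.
rewrite dotmxE mxE (reindex _ (curry_mxvec_bij m n)) /= /hsdot /mxtrace.
transitivity (\sum_i \sum_j A i j * (B ^t*) j i).
  by apply: eq_bigr => i _; rewrite mxE.
rewrite pair_bigA; apply: eq_bigr => -[i j] _ /=.
by rewrite !mxE !mxvecE.
Qed.

Lemma hsdotC m n (A B : 'M[C]_(m, n)) : hsdot B A = (hsdot A B)^*.
Proof.
by rewrite /hsdot -trace_map_mx -[RHS]mxtrace_tr map_trmx adjmxM trmxCK.
Qed.

Lemma hsdotDl m n (A B D : 'M[C]_(m, n)) :
  hsdot (A + B) D = hsdot A D + hsdot B D.
Proof. by rewrite /hsdot mulmxDl linearD. Qed.

Lemma hsdotDr m n (A B D : 'M[C]_(m, n)) :
  hsdot D (A + B) = hsdot D A + hsdot D B.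
Proof. by rewrite /hsdot adjmxD mulmxDr linearD. Qed.

Lemma hsdotZl m n (a : C) (A B : 'M[C]_(m, n)) :
  hsdot (a *: A) B = a * hsdot A B.
Proof. by rewrite /hsdot -scalemxAl linearZ. Qed.

Lemma hsdotZr m n (a : C) (A B : 'M[C]_(m, n)) :
  hsdot A (a *: B) = a^* * hsdot A B.
Proof. by rewrite /hsdot adjmxZ -scalemxAr linearZ. Qed.

Lemma hsdot_ge0 m n (A : 'M[C]_(m, n)) : 0 <= hsdot A A.
Proof.
rewrite hsdotE; have [->|/dotmx_is_dotmx/ltW//] := eqVneq (mxvec A) 0.
by rewrite linear0l.
Qed.

Lemma hsdot_CauchySchwarz m n (A B : 'M[C]_(m, n)) :
  `|hsdot A B| <= sqrtC (hsdot A A) * sqrtC (hsdot B B).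
Proof. by rewrite !hsdotE; exact: CauchySchwarz_sqrt. Qed.

(** Both bounds are the nonnegativity of a squared norm, that of [Q A] and that
    of [(1 - Q) A]. *)
Lemma hsdot_proj m n (Q : 'M[C]_m) (A : 'M[C]_(m, n)) :
  Q ^t* = Q -> Q *m Q = Q -> 0 <= hsdot (Q *m A) A <= hsdot A A.
Proof.
have key (P : 'M[C]_m) : P ^t* = P -> P *m P = P -> 0 <= hsdot (P *m A) A.
  move=> Ph Pi.
  suff -> : hsdot (P *m A) A = hsdot (P *m A) (P *m A) by exact: hsdot_ge0.
  by rewrite /hsdot adjmxM Ph !mulmxA [RHS]mxtrace_mulC !mulmxA Pi.
move=> Qh Qi; rewrite key//= -subr_ge0.
have -> : hsdot A A - hsdot (Q *m A) A = hsdot ((1%:M - Q) *m A) A.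
  by rewrite /hsdot [in RHS]mulmxBl mul1mx [in RHS]mulmxBl linearB.
apply: key; first by rewrite adjmxB adjmx1 Qh.
by rewrite mulmxBl mul1mx mulmxBr mulmx1 Qi subrr subr0.
Qed.

End HilbertSchmidt.

(** * Positive matrices as squares *)

Section Positive.
Context {C : numClosedFieldType} {d : nat}.
Implicit Types A B : 'M[C]_d.

Lemma innerC (u v : 'cV[C]_d) : inner v u = (inner u v)^*.
Proof.
have -> : (inner u v)^* = ((u ^t* *m v) ^t*) 0 0.
  by rewrite [RHS]mxE [in RHS]mxE.
by rewrite adjmxM trmxCK.
Qed.

(** Polarization: the values on [u + v] and [u + 'i v] determine those on the
    pair [(u, v)]; this is where complex scalars are needed. *)
Lemma inner_mulmx_eq0 B : (forall u, inner u (B *m u) = 0) -> B = 0.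
Proof.
move=> B0.
have inDZ u v (a : C) : inner (u + a *: v) (B *m (u + a *: v)) =
    inner u (B *m u) + a * inner u (B *m v) + a^* * inner v (B *m u)
    + a^* * a * inner v (B *m v).
  rewrite /inner adjmxD adjmxZ mulmxDl !mulmxDr -!scalemxAr -!scalemxAl.
  by rewrite -?scalemxAr !mxE; ring.
apply/matrixP => i j; rewrite mxE.
pose u : 'cV[C]_d := delta_mx i 0; pose v : 'cV[C]_d := delta_mx j 0.
have <- : inner u (B *m v) = B i j.
  by rewrite /inner /u /v -colE trmx_delta map_delta_mx -rowE !mxE.
have := inDZ u v 'i; have := inDZ u v 1; rewrite !B0 conjC1 conjCi.
rewrite !mul1r !mulr0 !addr0 !add0r => e1 e2.
have e3 : inner v (B *m u) = - inner u (B *m v).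
  by apply/eqP; rewrite -addr_eq0 addrC -e1.
move: e2; rewrite e3 mulNr mulrN opprK -mulrDr => /esym/eqP.
rewrite mulf_eq0 (negPf (neq0Ci _)) /= -mulr2n mulrn_eq0 /=.
by move/eqP.
Qed.

Lemma psdmx_adj A : psdmx A -> A ^t* = A.
Proof.
move=> A0; apply/eqP; rewrite -subr_eq0; apply/eqP/inner_mulmx_eq0 => u.
have -> : inner u ((A ^t* - A) *m u) = (inner u (A *m u))^* - inner u (A *m u).
  by rewrite -innerC /inner adjmxM mulmxBl mulmxBr !mulmxA !mxE.
by rewrite (CrealP (ger0_real (A0 u))) subrr.
Qed.

Lemma psdmx_gram A : psdmx (A ^t* *m A).
Proof.
move=> u; have -> : inner u (A ^t* *m A *m u) = hsdot (A *m u) (A *m u).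
  by rewrite /hsdot mxtrace_mulC trace_mx11 adjmxM /inner !mulmxA.
exact: hsdot_ge0.
Qed.

Lemma psdmx_spectral A : psdmx A ->
  spectralmx A *m A *m (spectralmx A) ^t* = diag_mx (spectral_diag A).
Proof.
move=> A0; have An : A \is normalmx by apply/normalmxP; rewrite psdmx_adj.
have Vu := spectral_unitarymx A.
have /orthomx_spectralP AE := An.
move: AE Vu; set V := spectralmx A; set D := spectral_diag A => + Vu.
rewrite invmx_unitary// => AE; have VV : V *m V ^t* = 1%:M by apply/unitarymxP.
by rewrite [in LHS]AE !mulmxA VV mul1mx -mulmxA VV mulmx1.
Qed.

Lemma psdmx_spectral_ge0 A i : psdmx A -> 0 <= spectral_diag A 0 i.
Proof.
move=> A0; pose V := spectralmx A.
(* The columns of V^t* are the eigenvectors of A. *)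
have -> : spectral_diag A 0 i = inner (col i (V ^t*)) (A *m col i (V ^t*)).
  have /matrixP/(_ i i) := psdmx_spectral A0.
  rewrite [in RHS]mxE eqxx mulr1n => <-.
  rewrite /inner !colE adjmxM trmxCK trmx_delta map_delta_mx.
  by rewrite -!mulmxA -rowE [RHS]mxE !mulmxA -colE [RHS]mxE.
exact: A0.
Qed.

(** The columns of [X] are the eigenvectors of [A], scaled by the square roots
    of the eigenvalues. *)
Lemma psdmx_factor A : psdmx A -> exists X : 'M[C]_d, A = X *m X ^t*.
Proof.
move=> A0; have VAV := psdmx_spectral A0; have D0 i := psdmx_spectral_ge0 i A0.
have Vu := spectral_unitarymx A; set V := spectralmx A in VAV Vu.
exists (V ^t* *m diag_mx (map_mx sqrtC (spectral_diag A))).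
rewrite adjmxM trmxCK adjmx_diag mulmxA -(mulmxA (V ^t*)) mulmx_diag.
have AE : A = V ^t* *m diag_mx (spectral_diag A) *m V.
  by rewrite -VAV !mulmxA mulmxKtV// -(invmx_unitary Vu) mulVmx ?mul1mx//
     unitarymx_unit.
rewrite {1}AE; congr (_ *m diag_mx _ *m _); apply/rowP => i; rewrite !mxE.
by rewrite (CrealP (ger0_real _)) ?sqrtC_ge0// -expr2 sqrtCK.
Qed.

Lemma density_factor (rho : 'M[C]_d) : density rho ->
  exists2 X : 'M[C]_d, rho = X *m X ^t* & hsdot X X = 1.
Proof.
by case=> /psdmx_factor[X rhoE] tr1; exists X; rewrite // /hsdot -rhoE.
Qed.

End Positive.

(** * The trace norm of a difference of two states *)

Section TraceNorm.
Context {C : numClosedFieldType} {d : nat}.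
Implicit Types A B : 'M[C]_d.

(** By polar decomposition, some partial isometry [S] satisfies [S A = |A|], so
    that the trace norm becomes a linear expression in [A]. *)
Lemma mxtrace_absmx_polar A : exists S : 'M[C]_d,
  [/\ \tr (absmx A) = \tr (S *m A), 0 <= \tr (absmx A) &
      S *m S ^t* *m (S *m S ^t*) = S *m S ^t*].
Proof.
rewrite /absmx; set G := A ^t* *m A.
have Vu := spectral_unitarymx G.
have VGV := psdmx_spectral (psdmx_gram A).
have D0 i := psdmx_spectral_ge0 i (psdmx_gram A).
rewrite invmx_unitary//.
move: Vu VGV D0; rewrite -/G.
set V := spectralmx G; set D := spectral_diag G => Vu VGV D0.
have VV : V *m V ^t* = 1%:M by apply/unitarymxP.
(* With 0^-1 = 0, the diagonal matrix e is the partial inverse of |A|, and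
   S = |A|^-1 A^* is the adjoint of the partial isometry of the polar
   decomposition of A. *)
pose e : 'rV[C]_d := map_mx (fun x => (sqrtC x)^-1) D.
have eR : map_mx Num.conj e = e.
  apply/rowP => i; rewrite !mxE; apply/CrealP.
  by rewrite realV ger0_real// sqrtC_ge0.
have trE : \tr (V ^t* *m diag_mx (map_mx sqrtC D) *m V) = \sum_i sqrtC (D 0 i).
  rewrite mxtrace_mulC mulmxA VV mul1mx mxtrace_diag.
  by apply: eq_bigr => i _; rewrite mxE.
pose S := V ^t* *m diag_mx e *m V *m A ^t*.
have SS : S *m S ^t* =
    V ^t* *m diag_mx (map_mx (fun x => (x != 0)%:R) D) *m V.
  transitivity (V ^t* *m (diag_mx e *m (V *m G *m V ^t*) *m diag_mx e) *m V).
    by rewrite /S !adjmxM !trmxCK adjmx_diag eR /G !mulmxA.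
  rewrite VGV !mulmx_diag; congr (_ *m diag_mx _ *m _).
  apply/rowP => i; rewrite !mxE.
  have [->|D0'] := eqVneq (D 0 i) 0; first by rewrite mulr0 mul0r.
  by rewrite mulrAC -invfM -expr2 sqrtCK mulVf.
exists S; split.
- rewrite trE; transitivity (\tr (diag_mx e *m (V *m G *m V ^t*))); last first.
    by rewrite mulmxA mxtrace_mulC /S /G !mulmxA.
  rewrite VGV mulmx_diag mxtrace_diag.
  apply: eq_bigr => i _; rewrite !mxE.
  have [->|D0'] := eqVneq (D 0 i) 0; first by rewrite mulr0 sqrtC0.
  by rewrite mulrC -[X in X / _]sqrtCK expr2 mulfK// sqrtC_eq0.
- by rewrite trE; apply: sumr_ge0 => i _; rewrite sqrtC_ge0.
- rewrite SS !mulmxA -(mulmxA _ V) VV mulmx1 -(mulmxA (V ^t*)) mulmx_diag.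
  congr (_ *m diag_mx _ *m _); apply/rowP => i; rewrite !mxE.
  by case: eqP; rewrite ?mulr0 ?mulr1.
Qed.

(** For [S] as in the polar decomposition, [\tr (S X Y^t* )] is the inner
    product of [X] with [S^t* Y], whose norm is at most that of [Y]. *)
Lemma mxtrace_absmx_le n (B D : 'M[C]_(d, n)) :
  \tr (absmx (B *m D ^t* + D *m B ^t*)) <=
    2 * (sqrtC (hsdot B B) * sqrtC (hsdot D D)).
Proof.
have [S [trE tr_ge0 SS]] := mxtrace_absmx_polar (B *m D ^t* + D *m B ^t*).
have key (X Y : 'M[C]_(d, n)) :
    `|\tr (S *m (X *m Y ^t*))| <= sqrtC (hsdot X X) * sqrtC (hsdot Y Y).
  have -> : \tr (S *m (X *m Y ^t*)) = hsdot X (S ^t* *m Y).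
    by rewrite /hsdot adjmxM trmxCK mxtrace_mulC !mulmxA.
  apply: (le_trans (hsdot_CauchySchwarz _ _)).
  apply: ler_wpM2l; first by rewrite sqrtC_ge0 hsdot_ge0.
  rewrite ler_sqrtC ?qualifE/= ?hsdot_ge0//.
  have -> : hsdot (S ^t* *m Y) (S ^t* *m Y) = hsdot (S *m S ^t* *m Y) Y.
    by rewrite /hsdot adjmxM trmxCK !mulmxA [LHS]mxtrace_mulC !mulmxA.
  have SSh : (S *m S ^t*) ^t* = S *m S ^t* by rewrite adjmxM trmxCK.
  by have /andP[] := hsdot_proj Y SSh SS.
rewrite -(ger0_norm tr_ge0) trE mulmxDr linearD/= (le_trans (ler_normD _ _))//.
by rewrite mulr2n mulrDl mul1r lerD// 1?[X in _ <= X]mulrC.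
Qed.

(** This extends to purifications, as an upper bound, the formula for the
    distance between two pure states, which is the case [n = 1].
    It follows from the identity
    [2 (X X^t* - Y Y^t* ) = (X - Y) (X + Y)^t* + (X + Y) (X - Y)^t*], since the
    squared norms of [X - Y] and [X + Y] are [2 - 2 t] and [2 + 2 t]. *)
Lemma trace_norm_purification n (X Y : 'M[C]_(d, n)) (t : C) :
  hsdot X X = 1 -> hsdot Y Y = 1 -> hsdot X Y = t -> t \is Num.real ->
  trace_norm (X *m X ^t* - Y *m Y ^t*) <= sqrtC (1 - t ^+ 2).
Proof.
move=> XX YY XY tR.
have YX : hsdot Y X = t by rewrite hsdotC XY; exact/CrealP.
have h2 : (2^-1 : C)^* = 2^-1 by apply/CrealP; rewrite realV realn.
pose B := 2^-1 *: (X - Y); pose D := X + Y.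
have E : X *m X ^t* - Y *m Y ^t* = B *m D ^t* + D *m B ^t*.
  rewrite /B /D adjmxZ h2 -scalemxAl -scalemxAr -scalerDr adjmxB adjmxD.
  rewrite !mulmxBl !mulmxBr !mulmxDl !mulmxDr.
  by apply/matrixP => i j; rewrite !mxE; field.
have BB : hsdot B B = 2^-1 * (1 - t).
  rewrite /B hsdotZl hsdotZr h2 -scaleN1r !hsdotDl !hsdotDr !hsdotZl !hsdotZr.
  by rewrite rmorphN1 XX YY XY YX; field.
have DD : hsdot D D = 2 * (1 + t).
  by rewrite /D !hsdotDl !hsdotDr XX YY XY YX; ring.
rewrite E /trace_norm ler_pdivrMl ?ltr0n//.
apply: (le_trans (mxtrace_absmx_le B D)).
have BD0 : 0 <= hsdot B B by exact: hsdot_ge0.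
have DD0 : 0 <= hsdot D D by exact: hsdot_ge0.
rewrite -rootCMl// BB DD.
by rewrite (_ : 2^-1 * (1 - t) * (2 * (1 + t)) = 1 - t ^+ 2)//; field.
Qed.

End TraceNorm.

(** * Measurement matrices with two levels *)

Section TwoLevel.
Context {C : numClosedFieldType} {d n : nat}.
Variables (m h : C) (P : 'M[C]_d) (X : 'M[C]_(d, n)).
Hypotheses (m_gt0 : 0 < m) (m_le_h : m <= h).
Hypotheses (Ph : P ^t* = P) (PP : P *m P = P) (X1 : hsdot X X = 1).

(* K acts as m on the kernel of P and as h on its range. *)
Let K := m *: (1%:M - P) + h *: P.
Let p := hsdot (P *m X) X.
Let rho := X *m X ^t*.

Let h_gt0 : 0 < h. Proof. exact: lt_le_trans m_le_h. Qed.
Let m_ge0 : 0 <= m. Proof. exact: ltW m_gt0. Qed.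
Let h_ge0 : 0 <= h. Proof. exact: ltW h_gt0. Qed.
Let p01 : 0 <= p <= 1. Proof. by rewrite -X1; exact: hsdot_proj. Qed.

Lemma two_level_adj : K ^t* = K.
Proof.
rewrite /K adjmxD !adjmxZ adjmxB adjmx1 Ph.
by rewrite !(CrealP (gtr0_real _)).
Qed.

Lemma two_level_sqr : K *m K = (m ^+ 2) *: (1%:M - P) + (h ^+ 2) *: P.
Proof.
rewrite /K !mulmxDl !mulmxDr -!scalemxAl -!scalemxAr.
rewrite !mulmxBl !mulmxBr !mul1mx !mulmx1 PP !scalerA -!expr2.
by rewrite !subrr subr0 !scaler0 addr0 add0r.
Qed.

Lemma two_level_trace (a b : C) :
  \tr (rho *m (a *: (1%:M - P) + b *: P)) = a * (1 - p) + b * p.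
Proof.
have rhoP : \tr (rho *m P) = p by rewrite mxtrace_mulC /p /hsdot /rho mulmxA.
have rho1 : \tr rho = 1 by rewrite -X1.
rewrite mulmxDr linearD -!scalemxAr !linearZ/= mulmxBr mulmx1 linearB/=.
by rewrite rhoP rho1.
Qed.

Let q := \tr (rho *m (K ^t* *m K)).

Lemma two_level_prob : q = m ^+ 2 * (1 - p) + h ^+ 2 * p.
Proof. by rewrite /q two_level_adj two_level_sqr two_level_trace. Qed.

Lemma two_level_prob_bounds : m ^+ 2 <= q <= h ^+ 2.
Proof.
have /andP[p0 p1] := p01.
have mh : 0 <= h ^+ 2 - m ^+ 2.
  by rewrite subr_ge0 ler_sqr ?qualifE/=.
rewrite two_level_prob -subr_ge0 -[X in _ && X]subr_ge0.
have -> : m ^+ 2 * (1 - p) + h ^+ 2 * p - m ^+ 2 =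
  (h ^+ 2 - m ^+ 2) * p by ring.
have -> : h ^+ 2 - (m ^+ 2 * (1 - p) + h ^+ 2 * p) =
  (h ^+ 2 - m ^+ 2) * (1 - p) by ring.
by apply/andP; split; rewrite mulr_ge0// subr_ge0.
Qed.

(** The factor [X] purifies [rho], and [K X / sqrt q] purifies the
    post-measurement state, so only their overlap [s / sqrt q] matters.  That
    overlap is smallest at [p = m / (m + h)], where the square completed below
    vanishes. *)
Lemma two_level_gentle :
  trace_norm (rho - q^-1 *: (K *m rho *m K ^t*)) <= (h - m) / (h + m).
Proof.
have /andP[p0 p1] := p01.
have /andP[q0 _] := two_level_prob_bounds.
have {}q0 : 0 < q by apply: lt_le_trans q0; rewrite exprn_gt0.
set s := m * (1 - p) + h * p.
have s0 : 0 <= s by rewrite addr_ge0// mulr_ge0// subr_ge0.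
set r := (sqrtC q)^-1.
have r0 : 0 <= r by rewrite invr_ge0 sqrtC_ge0 ltW.
have rr : r ^+ 2 = q^-1 by rewrite exprVn sqrtCK.
have rC : r^* = r by apply/CrealP/ger0_real.
pose Y := r *: (K *m X).
have -> : q^-1 *: (K *m rho *m K ^t*) = Y *m Y ^t*.
  rewrite /Y /rho adjmxZ rC adjmxM -scalemxAl -scalemxAr scalerA -expr2 rr.
  by rewrite !mulmxA.
have YY : hsdot Y Y = 1.
  rewrite /Y hsdotZl hsdotZr rC mulrA -expr2 rr /hsdot adjmxM.
  have -> : \tr (K *m X *m (X ^t* *m K ^t*)) = q.
    by rewrite /q [in RHS]mulmxA [RHS]mxtrace_mulC /rho !mulmxA.
  by rewrite mulVf// gt_eqF.
have XY : hsdot X Y = r * s.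
  rewrite /Y hsdotZr rC /hsdot adjmxM two_level_adj mulmxA -/rho.
  by rewrite two_level_trace.
have rsR : r * s \is Num.real by rewrite ger0_real// mulr_ge0.
apply: (le_trans (trace_norm_purification X1 YY XY rsR)).
have hm0 : 0 < h + m by rewrite addr_gt0.
set g := (h - m) / (h + m).
have g0 : 0 <= g by rewrite mulr_ge0 ?invr_ge0 ?(ltW hm0)// subr_ge0.
have rs2 : 1 - (r * s) ^+ 2 = g ^+ 2 * (1 - ((1 - p) * m - p * h) ^+ 2 / q).
  rewrite exprMn rr /g two_level_prob /s; field.
  by rewrite -two_level_prob !gt_eqF.
(* The same quantity in a form that shows it to be nonnegative, as comparing
   square roots requires. *)
have rs2' : 1 - (r * s) ^+ 2 = p * (1 - p) * (h - m) ^+ 2 / q.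
  rewrite exprMn rr two_level_prob /s; field.
  by rewrite -two_level_prob !gt_eqF.
have cR : (1 - p) * m - p * h \is Num.real.
  by rewrite rpredB// ger0_real// mulr_ge0// subr_ge0.
rewrite -[leRHS](sqrCK g0) ler_sqrtC ?qualifE/= ?exprn_ge0//.
  rewrite rs2 ler_piMr ?exprn_ge0// gerBl mulr_ge0 ?invr_ge0 ?(ltW q0)//.
  by rewrite real_exprn_even_ge0.
rewrite rs2' mulr_ge0 ?invr_ge0 ?(ltW q0)// mulr_ge0 ?exprn_ge0 ?subr_ge0//.
by rewrite mulr_ge0// subr_ge0.
Qed.

End TwoLevel.

(** * Finite outcome sets *)

(** The net of partial sums is constant from the full outcome set onwards. *)
Lemma finite_measurement (R : realType) (d : nat) (Omega : finType)
    (M : Omega -> 'M[R[i]]_d) :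
  \sum_w effect M w = 1%:M -> is_measurement M.
Proof.
move=> sum1; rewrite /is_measurement.
have FF := @totally_filter Omega.
apply: cvg_near_cst.
exists [fset w in enum Omega]%fset => // B /= /fsubsetP sB.
rewrite /partial_sum -(big_seq_fsetE _ _ predT (effect M)) /= -sum1.
apply: perm_big; apply: uniq_perm.
- exact: fset_uniq.
- exact: index_enum_uniq.
- by move=> w; rewrite mem_index_enum sB// in_fset/= mem_enum.
Qed.

(** * Matrices diagonal in an orthonormal basis *)

Lemma conjC_real_complex (R : realType) (x : R) : Num.conj x%:C = x%:C.
Proof. exact: conjc_real. Qed.

Section OrthonormalDiagonal.
Context {C : numClosedFieldType} {d : nat}.
Variable ket : 'I_d -> 'cV[C]_d.
Hypothesis ket_onb : orthonormal_basis ket.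

Definition diagonal_in (a : 'I_d -> C) : 'M[C]_d :=
  \sum_k a k *: outer (ket k) (ket k).

Lemma outer_mul (u v w x : 'cV[C]_d) :
  outer u v *m outer w x = inner v w *: outer u x.
Proof.
rewrite /outer mulmxA -(mulmxA u) [v ^t* *m w]mx11_scalar mul_mx_scalar.
by rewrite -scalemxAl.
Qed.

Lemma eq_diagonal_in a b : a =1 b -> diagonal_in a = diagonal_in b.
Proof. by move=> ab; apply: eq_bigr => k _; rewrite ab. Qed.

Lemma diagonal_inM a b :
  diagonal_in a *m diagonal_in b = diagonal_in (fun k => a k * b k).
Proof.
rewrite /diagonal_in mulmx_suml; apply: eq_bigr => k _.
rewrite mulmx_sumr (bigD1 k)//= big1 ?addr0 => [|j jk].
  by rewrite -scalemxAl -scalemxAr outer_mul ket_onb eqxx scale1r scalerA.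
rewrite -scalemxAl -scalemxAr outer_mul ket_onb eq_sym (negPf jk).
by rewrite scale0r !scaler0.
Qed.

Lemma diagonal_in_adj a : (diagonal_in a) ^t* = diagonal_in (fun k => (a k)^*).
Proof.
rewrite /diagonal_in raddf_sum /= map_mx_sum.
by apply: eq_bigr => k _; rewrite adjmxZ /outer adjmxM trmxCK.
Qed.

(** Orthonormality says that the matrix [U] of kets satisfies [U^t* U = 1]; the
    completeness relation is [U U^t* = 1], and [U] is square. *)
Lemma diagonal_in1 : diagonal_in (fun=> 1) = 1%:M.
Proof.
pose U : 'M[C]_d := \matrix_(i, j) ket j i 0.
have UU : U ^t* *m U = 1%:M.
  apply/matrixP => i j; rewrite [RHS]mxE -ket_onb /inner !mxE.
  by apply: eq_bigr => k _; rewrite !mxE.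
rewrite -(mulmx1C UU); apply/matrixP => i j.
rewrite /diagonal_in summxE [RHS]mxE; apply: eq_bigr => k _.
by rewrite scale1r /outer !mxE big_ord1 !mxE.
Qed.

Lemma diagonal_inD a b :
  diagonal_in a + diagonal_in b = diagonal_in (fun k => a k + b k).
Proof.
by rewrite /diagonal_in -big_split; apply: eq_bigr => k _; rewrite scalerDl.
Qed.

Lemma diagonal_inZ x a : x *: diagonal_in a = diagonal_in (fun k => x * a k).
Proof.
by rewrite /diagonal_in scaler_sumr; apply: eq_bigr => k _; rewrite scalerA.
Qed.

(** Born's rule: [gamma k] is the amplitude of [psi] on [ket k]. *)
Lemma diagonal_in_expectation (a gamma : 'I_d -> C) (psi : 'cV[C]_d) :
  psi = \sum_j gamma j *: ket j ->
  \tr (outer psi psi *m diagonal_in a) = \sum_k `|gamma k| ^+ 2 * a k.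
Proof.
move=> psiE; rewrite /diagonal_in mulmx_sumr raddf_sum /=.
have innerP k : inner (ket k) psi = gamma k.
  rewrite psiE /inner mulmx_sumr summxE (bigD1 k)//= big1 => [|j jk].
    by rewrite -scalemxAr mxE [X in _ * X]ket_onb eqxx mulr1 addr0.
  by rewrite -scalemxAr mxE [X in _ * X]ket_onb eq_sym (negPf jk) mulr0.
apply: eq_bigr => k _.
rewrite -scalemxAr linearZ /= outer_mul linearZ /= mulrC; congr (_ * _).
have -> : \tr (outer psi (ket k)) = inner (ket k) psi.
  by rewrite /outer mxtrace_mulC trace_mx11.
have -> : inner psi (ket k) = (inner (ket k) psi)^*.
  have -> : (inner (ket k) psi)^* = (((ket k) ^t* *m psi) ^t*) 0 0.
    by rewrite [RHS]mxE [in RHS]mxE.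
  by rewrite adjmxM trmxCK.
by rewrite innerP mulrC -normCK.
Qed.

End OrthonormalDiagonal.

(** * The mechanism *)

Section Mechanism.
Context {R : realType} {d : nat}.
Variables (delta : R) (ket : 'I_d -> 'cV[R[i]]_d).
Hypothesis (ket_onb : orthonormal_basis ket).
Implicit Types (w : {ffun 'I_d -> bool}).

Let c : R := expR (delta / 2) / (expR (delta / 2) + 1).
Let M := meas_delta delta ket.

Let c_gt0 : 0 < c. Proof. by rewrite divr_gt0 ?addr_gt0 ?expR_gt0. Qed.
Let c_ge0 : 0 <= c. Proof. exact: ltW. Qed.

(** Only position [k] differs from the comparison of [w] with the zero string:
    it contributes [1 - w k] in place of [w k]. *)
Lemma l1dist_std_basis w k :
  l1dist w (std_basis k) = (\sum_i (w i)%:R + 1 - 2 * (w k)%:R) :> R.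
Proof.
rewrite /l1dist (bigD1 k)//= [in RHS](bigD1 k)//= /std_basis ffunE eqxx.
rewrite (eq_bigr (fun i => (w i)%:R)) => [|i ik].
  case: (w k); rewrite /= ?mulr0n ?mulr1n ?subrr ?normr0 ?sub0r ?normrN1;
  by ring.
by rewrite ffunE (negPf ik) subr0 ger0_norm.
Qed.

Lemma meas_delta_diag w : M w = diagonal_in ket
  (fun k =>
     (c `^ (d%:R / 2) * expR (- (delta / 4) * l1dist w (std_basis k)))%:C).
Proof.
rewrite /M /meas_delta -/c -/(diagonal_in ket _) diagonal_inZ.
by apply: eq_diagonal_in => k; rewrite rmorphM.
Qed.

Lemma effect_meas_delta w : effect M w = diagonal_in ket
  (fun k => (c ^+ d * expR (- (delta / 2) * l1dist w (std_basis k)))%:C).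
Proof.
rewrite /effect meas_delta_diag diagonal_in_adj diagonal_inM//.
apply: eq_diagonal_in => k; rewrite conjC_real_complex -rmorphM /=.
congr (_ %:C); rewrite mulrACA -expRD; congr (_ * expR _); last by field.
by rewrite -expr2 -[LHS]powR_mulrn ?powR_ge0// -powRrM divfK ?pnatr_eq0//
  powR_mulrn.
Qed.

(** The exponential turns the distance into a product over the positions, so
    the sum over all strings is a product of two-term sums. *)
Lemma sum_expR_l1dist (a : R) (v : {ffun 'I_d -> bool}) :
  \sum_(w : {ffun _ -> bool}) expR (- a * l1dist w v) = (1 + expR (- a)) ^+ d.
Proof.
pose F (i : 'I_d) (b : bool) : R := expR (- a * `|b%:R - (v i)%:R|).
transitivity (\sum_(w : {ffun _ -> bool}) \prod_i F i (w i)).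
  by apply: eq_bigr => w _; rewrite /l1dist mulr_sumr expR_sum.
rewrite -(bigA_distr_bigA F) -[in RHS](card_ord d) -prodr_const.
apply: eq_bigr => i _; rewrite big_bool /F.
case: (v i); rewrite ?subrr ?subr0 ?sub0r ?normrN1 ?normr0 ?normr1.
  by rewrite mulr0 mulr1 expR0.
by rewrite mulr0 mulr1 expR0 addrC.
Qed.

Lemma meas_delta_measurement : is_measurement M.
Proof.
apply: finite_measurement.
under eq_bigr do rewrite effect_meas_delta.
rewrite /diagonal_in exchange_big /= -[RHS](diagonal_in1 ket_onb).
apply: eq_bigr => k _; rewrite -scaler_suml -rmorph_sum /=.
rewrite -mulr_sumr sum_expR_l1dist -exprMn.
(* The normalizing constant of each position. *)
rewrite (_ : c * _ = 1) ?expr1n//.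
have e0 := expR_gt0 (delta / 2); rewrite /c expRN; field.
by rewrite !gt_eqF// addr_gt0.
Qed.

(** The eigenvalue of [M w] on the kets [k] with [w k = false]. *)
Definition low_level w : R :=
  c `^ (d%:R / 2) * expR (- (delta / 4) * (\sum_i (w i)%:R + 1)).
Definition high_level w : R := expR (delta / 2) * low_level w.
(** The orthogonal projector onto the kets [k] with [w k = true]. *)
Definition selector w : 'M[R[i]]_d := diagonal_in ket (fun k => (w k)%:R).

Lemma meas_delta_two_level w :
  M w =
  (low_level w)%:C *: (1%:M - selector w) + (high_level w)%:C *: selector w.
Proof.
rewrite -(diagonal_in1 ket_onb) -scaleN1r !diagonal_inZ diagonal_inD.
rewrite !diagonal_inZ diagonal_inD meas_delta_diag.
apply: eq_diagonal_in => k; rewrite l1dist_std_basis /high_level /low_level.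
case: (w k) => /=; rewrite !(mulr0, mulr1, addr0, subr0, subrr, add0r)//.
by rewrite mulrCA -expRD; congr ((_ * expR _)%:C); field.
Qed.

Lemma selector_adj w : (selector w) ^t* = selector w.
Proof.
rewrite /selector diagonal_in_adj; apply: eq_diagonal_in => k.
by rewrite conjC_nat.
Qed.

Lemma selector_sqr w : selector w *m selector w = selector w.
Proof.
rewrite /selector diagonal_inM//; apply: eq_diagonal_in => k.
by case: (w k); rewrite ?mulr1 ?mulr0.
Qed.

Lemma low_level_gt0 w : 0 < (low_level w)%:C.
Proof. by rewrite ltcR mulr_gt0 ?expR_gt0// powR_gt0. Qed.

Hypothesis delta_gt0 : 0 < delta.

Lemma low_level_le_high w : (low_level w)%:C <= (high_level w)%:C.
Proof.
have := low_level_gt0 w; rewrite lecR ltcR => l0.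
by rewrite ler_peMl ?(ltW l0)// -[leLHS]expR0 ler_expR divr_ge0// ltW.
Qed.

Lemma prob_meas_delta_bounds n (X : 'M[R[i]]_(d, n)) w : hsdot X X = 1 ->
  (low_level w)%:C ^+ 2 <= prob M (X *m X ^t*) w <= (high_level w)%:C ^+ 2.
Proof.
move=> X1; rewrite /prob /effect meas_delta_two_level.
exact: (two_level_prob_bounds (low_level_gt0 w) (low_level_le_high w)
  (selector_adj w) (selector_sqr w) X1).
Qed.

(** Both probabilities lie between the squares of the two levels, whose ratio is
    [expR delta]. *)
Lemma meas_delta_dp : quantum_dp delta density M.
Proof.
move=> _ _ w /density_factor[X -> X1] /density_factor[Y -> Y1].
have /andP[_ hX] := prob_meas_delta_bounds w X1.
have /andP[lY _] := prob_meas_delta_bounds w Y1.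
apply: (le_trans hX); apply: le_trans (ler_wpM2l _ lY); last first.
  by rewrite lecR expR_ge0.
have -> : (high_level w)%:C ^+ 2 = (expR delta)%:C * (low_level w)%:C ^+ 2.
  rewrite /high_level rmorphM exprMn -[in LHS]rmorphXn /= -expRM_natr.
  by rewrite divfK ?pnatr_eq0.
by [].
Qed.

Lemma meas_delta_gentle : gentle (tanh (delta / 4)) density M.
Proof.
move=> _ w /density_factor[X -> X1] _.
rewrite /post_state /prob /effect meas_delta_two_level.
have := two_level_gentle (low_level_gt0 w) (low_level_le_high w)
  (selector_adj w) (selector_sqr w) X1.
move/le_trans; apply.
(* Since h = expR (delta / 2) m, the quotient (h - m) / (h + m) is
   tanh (delta / 4). *)
have := low_level_gt0 w; rewrite ltcR => l0.
rewrite -rmorphB -rmorphD -fmorph_div /= lecR /high_level /tanh.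
have -> : delta / 2 = delta / 4 + delta / 4 by field.
have e0 := expR_gt0 (delta / 4); have ee0 := mulr_gt0 e0 e0.
rewrite expRD expRN le_eqVlt; apply/orP; left; apply/eqP; field.
by rewrite !gt_eqF ?addr_gt0 ?(mulr_gt0 ee0).
Qed.

End Mechanism.

Theorem lemma3 (R : realType) (d : nat) (delta : R)
    (ket : 'I_d -> 'cV[R[i]]_d) (delta_gt0 : 0 < delta)
    (ket_onb : orthonormal_basis ket) :
  [/\ is_measurement (meas_delta delta ket),
      quantum_dp delta density (meas_delta delta ket),
      gentle (tanh (delta / 4)) density (meas_delta delta ket) &
      forall (gamma : 'I_d -> R[i]) (psi : 'cV[R[i]]_d),
        psi = \sum_j gamma j *: ket j -> vnorm psi = 1 ->
        let rho := outer psi psi in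
        forall w : {ffun 'I_d -> bool},
          [/\ prob (meas_delta delta ket) rho w =
                ((expR (delta / 2) / (expR (delta / 2) + 1)) ^+ d)%:C *
                \sum_j `|gamma j| ^+ 2 *
                       (expR (- (delta / 2) * l1dist w (std_basis j)))%:C,
              0 < prob (meas_delta delta ket) rho w &
              post_state (meas_delta delta ket) rho w =
                (prob (meas_delta delta ket) rho w)^-1 *:
                (meas_delta delta ket w *m rho *m
                   (meas_delta delta ket w) ^t*)]].
Proof.
split; first exact: meas_delta_measurement.
- exact: meas_delta_dp.
- exact: meas_delta_gentle.
move=> gamma psi psiE psi1 rho w; split=> //.
- rewrite /prob effect_meas_delta// (diagonal_in_expectation ket_onb _ psiE).
  rewrite mulr_sumr; apply: eq_bigr => j _.
  by rewrite rmorphM mulrCA.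
- (* The column psi itself serves as the factor X of rho = X X^t*. *)
  have psi1' : hsdot psi psi = 1.
    rewrite /hsdot mxtrace_mulC trace_mx11 -/(inner psi psi).
    by rewrite -[LHS]sqrtCK -/(vnorm psi) psi1 expr1n.
  have /andP[] := prob_meas_delta_bounds ket_onb delta_gt0 w psi1'.
  move=> lb _; apply: lt_le_trans lb.
  by rewrite exprn_gt0// low_level_gt0.
Qed.
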